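(* There exist absolute constants $n_0,c>0$ such that for $n\ge n_0$ and $\mu\ge8\sqrt{\log n}$, there exist $\theta^\star_1,\dots,\theta^\star_n\in[-\mu,\mu]$ such that, with $\theta$ a uniformly random permutation of $\theta^\star$, $X\mid\theta\sim\mathcal N(\theta,I_n)$, $\widehat\theta^{\rm S}_i=\mathbb{E}[\theta_i\mid X_i]$ and $\widehat\theta^{\rm PI}_i=\mathbb{E}[\theta_i\mid X]$, $$\mathbb{E}\big[\|\widehat\theta^{\rm S}-\widehat\theta^{\rm PI}\|_2^2\big]\ge c\min\Big\{\frac{\mu}{\sqrt{\log n}},\;n\Big\}.$$
   Context: A uniformly random permutation of $\theta^\star$ means $\theta=(\theta^\star_{\pi(1)},\dots,\theta^\star_{\pi(n)})$ with $\pi$ uniform over permutations of $[n]$. *)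

(* Defs.v *)
From HB Require Import structures.
From mathcomp Require Import all_boot all_order all_algebra all_fingroup.
From mathcomp Require Import all_classical all_reals all_analysis.
Set Implicit Arguments. Unset Strict Implicit. Unset Printing Implicit Defensive.
Import Order.TTheory GRing.Theory Num.Theory.
Import numFieldNormedType.Exports.
Local Open Scope ring_scope.

Section Model.
Variable R : realType.

Definition phi (t : R) : R := expR (- (t ^+ 2) / 2) / Num.sqrt (2 * pi).

Definition upd (x : nat -> R) (k : nat) (t : R) : nat -> R :=
  fun j => if j == k then t else x j.

(* iterated Lebesgue integral over coordinates 0..k-1 (Tonelli: equals the
   k-dimensional Lebesgue integral for nonnegative measurable integrands) *)
Fixpoint iter_int (k : nat) (f : (nat -> R) -> \bar R) (x : nat -> R) : \bar R :=
  match k with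
  | 0 => f x
  | k'.+1 => (\int[@lebesgue_measure R]_t iter_int k' f (upd x k' t))%E
  end.

Definition integral_Rn (n : nat) (f : (nat -> R) -> \bar R) : \bar R :=
  iter_int n f (fun _ => 0).

Variable n : nat.
Variable ths : 'I_n -> R.

Definition lik (s : {perm 'I_n}) (x : nat -> R) : R :=
  \prod_(j : 'I_n) phi (x (val j) - ths (s j)).

(* separable Bayes estimator E[theta_i | X_i]: the marginal prior of theta_i
   is uniform on the multiset {ths_1,...,ths_n} *)
Definition est_S (i : 'I_n) (x : nat -> R) : R :=
  (\sum_(k : 'I_n) ths k * phi (x (val i) - ths k)) /
  (\sum_(k : 'I_n) phi (x (val i) - ths k)).

Definition est_PI (i : 'I_n) (x : nat -> R) : R :=
  (\sum_(s : {perm 'I_n}) ths (s i) * lik s x) /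
  (\sum_(s : {perm 'I_n}) lik s x).

Definition risk_gap : \bar R :=
  ((n`!%:R)^-1)%:E *
  (\sum_(s : {perm 'I_n})
     integral_Rn n (fun x =>
       ((\sum_(i : 'I_n) (est_S i x - est_PI i x) ^+ 2) * lik s x)%:E))%E.

End Model.

(* Main.v *)
Require Import Defs.
From HB Require Import structures.
From mathcomp Require Import all_boot all_order all_algebra all_fingroup.
From mathcomp Require Import all_classical all_reals all_analysis.
From mathcomp Require Import measurable_realfun ring lra zify.
Import Order.TTheory GRing.Theory Num.Theory.
Local Open Scope ring_scope.

(* Put K well separated pairs {c, c + 1} on the line and all other points at
   - mu. The permutation-invariant rule knows that each pair is used exactly
   once, so an observation near c + 1 makes a second one there less likely; the
   separable rule cannot see this.

   The permutation sums in the PI rule are never estimated. With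
   A_i = S_i - PI_i, for every statistic g,
     A_i^2 >= 2 lambda g A_i - lambda^2 g^2,
   and summing against the likelihoods replaces PI_i by theta_i. Near the pair
   at c use g = sum_{j <> i} 1{x_j >= c + 1/2} - sum_q m_q, where
   m_q = P(N(theta*_q, 1) >= c + 1/2). Given the permutation the coordinates are
   independent and g has conditional mean - m_{s i}, so the linear term is an
   integral of the covariance of theta* and m under the posterior weights of a
   single coordinate. Both are increasing in theta*, hence the covariance is at
   least the contribution of the pair itself. The quadratic term is bounded
   because only the pair contributes to the variance of g, up to Gaussian
   tails. Every pair thus contributes a constant. *)

(** * Iterated integrals *)

Section IteratedIntegral.
Context {R : realType}.
Local Notation leb := (@lebesgue_measure R).
Implicit Types (x : nat -> R) (k : nat).

(** For nonnegative functions the integral is a supremum over the simple functions below, a family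
    that grows with the function; the general case splits into positive and negative parts. This
    lets the signed test integrand be compared with the risk. *)
Lemma le_integral_nomeas d (T : measurableType d) (m : {measure set T -> \bar R})
    (f g : T -> \bar R) :
  (forall t, f t <= g t)%E -> (\int[m]_t f t <= \int[m]_t g t)%E.
Proof.
move=> fg; have mono (u v : T -> \bar R) : (forall t, 0 <= u t)%E ->
    (forall t, u t <= v t)%E -> (\int[m]_t u t <= \int[m]_t v t)%E.
  move=> u0 uv; have v0 t : (0 <= v t)%E by exact: le_trans (u0 t) (uv t).
  rewrite !ge0_integralTE//; apply: le_ereal_sup => _ [h hu <-].
  by exists h => // t; exact: le_trans (hu t) (uv t).
rewrite integralE [leRHS]integralE; apply: leeB; apply: mono => // t.
- by rewrite !funeposE; apply: le_max2 => //; rewrite fg.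
- by rewrite !funenegE; apply: le_max2 => //; rewrite leeN2 fg.
Qed.

Lemma le_iter_int k (f g : (nat -> R) -> \bar R) x :
  (forall y, f y <= g y)%E -> (iter_int k f x <= iter_int k g x)%E.
Proof.
move=> fg; elim: k x => [|k IHk] x //=.
by apply: le_integral_nomeas => t; exact: IHk.
Qed.

Lemma iter_int_ge0 k (f : (nat -> R) -> \bar R) x :
  (forall y, 0 <= f y)%E -> (0 <= iter_int k f x)%E.
Proof.
move=> f0; elim: k x => [|k IHk] x //=.
by apply: integral_ge0 => t _; exact: IHk.
Qed.

(* Joint measurability in the coordinates, phrased through arbitrary measurable
   parametrisations so that no sigma-algebra on [nat -> R] is needed. *)
Definition coord_measurable (f : (nat -> R) -> \bar R) : Prop :=
  forall d (T : measurableType d) (g : T -> nat -> R),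
    (forall j, measurable_fun setT (g ^~ j)) -> measurable_fun setT (f \o g).

Lemma measurable_upd d (T : measurableType d) (g : T -> nat -> R) k (h : T -> R) :
  (forall j, measurable_fun setT (g ^~ j)) -> measurable_fun setT h ->
  forall j, measurable_fun setT (fun t => upd (g t) k (h t) j).
Proof. by move=> mg mh j; rewrite /upd; case: (j == k). Qed.

(** Tonelli, with coordinate [k] adjoined to the parameter space as a real factor; this is why
    [coord_measurable] quantifies over all [T]. *)
Lemma coord_measurable_iter_int k (f : (nat -> R) -> \bar R) :
  (forall y, 0 <= f y)%E -> coord_measurable f ->
  coord_measurable (iter_int k f).
Proof.
move=> f0 mf; elim: k => [//|k IHk] d T g mg /=.
pose F (p : T * measurableTypeR R) := iter_int k f (upd (g p.1) k p.2).
have mF : measurable_fun setT F.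
  apply: (IHk _ _ (fun p : T * measurableTypeR R => upd (g p.1) k p.2)).
  apply: measurable_upd => [j|]; last exact: measurable_snd.
  exact: (measurableT_comp (mg j) (@measurable_fst _ _ _ _)).
have F0 p : (0 <= F p)%E by exact: iter_int_ge0.
exact: (measurable_fun_fubini_tonelli_F (m2 := leb) F mF F0).
Qed.

Lemma iter_int_sum (I : Type) (s : seq I) (f : I -> (nat -> R) -> \bar R) k x :
  (forall i y, 0 <= f i y)%E -> (forall i, coord_measurable (f i)) ->
  iter_int k (fun y => \sum_(i <- s) f i y)%E x =
  (\sum_(i <- s) iter_int k (f i) x)%E.
Proof.
move=> f0 mf; elim: k x => [//|k IHk] x /=.
under eq_integral do rewrite IHk.
rewrite ge0_integral_sum// => i; last by move=> t _; exact: iter_int_ge0.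
apply: (coord_measurable_iter_int k _ (f0 i) (mf i) _ _ (fun t : measurableTypeR R => upd x k t)).
by apply: measurable_upd => [j|]; [exact: measurable_cst|exact: measurable_id].
Qed.

(* [is_iint k F G]: integrating [F] over coordinates [0..k-1] successively meets
   only Lebesgue integrable functions and gives [G]; unlike [iter_int] this is
   meaningful and linear for signed [F]. *)
Fixpoint is_iint k (F G : (nat -> R) -> R) : Prop :=
  match k with
  | 0 => F =1 G
  | k'.+1 => exists2 H, is_iint k' F H & forall x,
      leb.-integrable setT (fun t => (H (upd x k' t))%:E) /\
      (G x)%:E = (\int[leb]_t (H (upd x k' t))%:E)%E
  end.

(** Bridge back to the integral of the statement: values found by linearity for signed integrands
    are values of [iter_int]. *)
Lemma is_iint_iter_int k F G x :
  is_iint k F G -> iter_int k (fun y => (F y)%:E) x = (G x)%:E.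
Proof.
elim: k G x => [|k IHk] G x /=; first by move=> ->.
move=> [H FH HG]; rewrite (HG x).2.
by apply: eq_integral => t _; exact: IHk.
Qed.

Lemma is_iint0 k : is_iint k (fun=> 0) (fun=> 0).
Proof.
elim: k => [//|k IHk] /=; exists (fun=> 0) => // x.
by split; [exact: integrable0|rewrite integral0].
Qed.

Lemma is_iintD k F1 G1 F2 G2 : is_iint k F1 G1 -> is_iint k F2 G2 ->
  is_iint k (fun x => F1 x + F2 x) (fun x => G1 x + G2 x).
Proof.
elim: k G1 G2 => [|k IHk] G1 G2 /=; first by move=> e1 e2 x; rewrite e1 e2.
move=> [H1 FH1 HG1] [H2 FH2 HG2]; exists (fun x => H1 x + H2 x); first exact: IHk.
move=> x; have [i1 e1] := HG1 x; have [i2 e2] := HG2 x; split.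
  by under eq_fun do rewrite EFinD; exact: integrableD.
by rewrite EFinD e1 e2 -integralD.
Qed.

Lemma is_iintZ k a F G : is_iint k F G ->
  is_iint k (fun x => a * F x) (fun x => a * G x).
Proof.
elim: k G => [|k IHk] G /=; first by move=> e x; rewrite e.
move=> [H FH HG]; exists (fun x => a * H x); first exact: IHk.
move=> x; have [i1 e1] := HG x; split.
  by under eq_fun do rewrite EFinM; exact: integrableZl.
by rewrite EFinM e1 -integralZl.
Qed.

Lemma is_iint_sum (I : Type) (s : seq I) (P : pred I) k
    (F G : I -> (nat -> R) -> R) :
  (forall i, P i -> is_iint k (F i) (G i)) ->
  is_iint k (fun x => \sum_(i <- s | P i) F i x)
            (fun x => \sum_(i <- s | P i) G i x).
Proof.
move=> FG; elim: s => [|i s IHs].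
  rewrite (_ : (fun x => _) = fun=> 0); last by apply/funext => x; rewrite big_nil.
  rewrite (_ : (fun x => \sum_(i <- [::] | _) G i x) = fun=> 0); last first.
    by apply/funext => x; rewrite big_nil.
  exact: is_iint0.
have [Pi|nPi] := boolP (P i).
  under eq_fun do rewrite big_cons Pi.
  under [X in is_iint k _ X]eq_fun do rewrite big_cons Pi.
  by apply: is_iintD => //; exact: FG.
under eq_fun do rewrite big_cons (negPf nPi).
by under [X in is_iint k _ X]eq_fun do rewrite big_cons (negPf nPi).
Qed.

(** The induction runs through partially integrated products: factors below [k] have become
    constants, the others are still functions of their coordinates. *)
Lemma is_iint_prod n (f : 'I_n -> R -> R) (k : nat) : (k <= n)%N ->
  (forall j, leb.-integrable setT (EFin \o f j)) ->
  is_iint k (fun x => \prod_(j < n) f j (x j))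
    (fun x => \prod_(j < n) (if (j < k)%N then \int[leb]_t f j t
                             else f j (x j))).
Proof.
move=> kn intf; elim: k kn => [_ x|k IHk kn] //=.
eexists; first exact: IHk (ltnW kn).
move=> x; pose k' := Ordinal kn.
pose c := \prod_(j < n | j != k') (if (j < k)%N then \int[leb]_t f j t else f j (x j)).
have -> : (fun t : R => (\prod_(j < n) (if (j < k)%N then \int[leb]_t f j t
      else f j (upd x k t j)))%:E) = (fun t => c%:E * (f k' t)%:E)%E.
  apply/funext => t; rewrite (bigD1 k')//= ltnn {1}/upd eqxx mulrC -EFinM.
  congr ((_ * _)%:E); apply: eq_bigr => j jk.
  by rewrite /upd; have /negPf -> : (j : nat) != k by [].
have ik := intf k'.
split; first exact: integrableZl.
rewrite integralZl// -[X in (_ * X)%E]fineK; last exact: integrable_fin_num.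
rewrite -EFinM (bigD1 k')//= ltnS leqnn mulrC; congr ((_ * _)%:E).
apply: eq_bigr => j jk; rewrite ltnS leq_eqVlt.
by have /negPf -> : (j : nat) != k by [].
Qed.

Lemma is_iint_prodT n (f : 'I_n -> R -> R) :
  (forall j, leb.-integrable setT (EFin \o f j)) ->
  is_iint n (fun x => \prod_(j < n) f j (x j))
    (fun=> \prod_(j < n) \int[leb]_t f j t).
Proof.
move=> intf; have := is_iint_prod _ _ _ (leqnn n) intf.
congr (is_iint _ _); apply/funext => x.
by apply: eq_bigr => j _; rewrite ltn_ord.
Qed.

End IteratedIntegral.

(** * Gaussian means on the line *)

Section Gauss.
Context {R : realType}.
Local Notation leb := (@lebesgue_measure R).
Implicit Types (t th : R) (u v : R -> R).

Lemma phiE th t : phi (t - th) = normal_pdf th 1 t.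
Proof.
rewrite normal_pdfE ?oner_neq0// /phi /normal_peak /normal_fun.
by rewrite !expr1n mul1r mulr_natl mulrC.
Qed.

Lemma phi_gt0 t : 0 < phi t.
Proof.
by rewrite divr_gt0 ?expR_gt0// sqrtr_gt0 mulr_gt0 ?pi_gt0.
Qed.

Lemma phi_ge0 t : 0 <= phi t. Proof. exact: ltW (phi_gt0 t). Qed.

Lemma phi_le_expR d s t : s ^+ 2 + d <= t ^+ 2 ->
  phi t <= expR (- d / 2) * phi s.
Proof.
move=> std; rewrite /phi mulrA -expRD ler_wpM2r ?invr_ge0 ?sqrtr_ge0//.
by rewrite ler_expR; lra.
Qed.

Lemma le_phi s t : s ^+ 2 <= t ^+ 2 -> phi t <= phi s.
Proof.
move=> st; have := phi_le_expR 0 s t.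
by rewrite addr0 oppr0 mul0r expR0 mul1r; exact.
Qed.

Lemma phi_le1 t : phi t <= 1.
Proof.
apply: (@le_trans _ _ (phi 0)); first by apply: le_phi; rewrite expr0n sqr_ge0.
rewrite /phi expr0n oppr0 mul0r expR0 div1r invf_le1; last first.
  by rewrite sqrtr_gt0 mulr_gt0 ?pi_gt0.
by rewrite -[leLHS]sqrtr1 ler_wsqrtr//; have := @pi_ge2 R; lra.
Qed.

Lemma measurable_phi th : measurable_fun setT (fun t => phi (t - th)).
Proof. by under eq_fun do rewrite phiE; exact: measurable_normal_pdf. Qed.

Lemma integrable_phi th : leb.-integrable setT (fun t => (phi (t - th))%:E).
Proof. by under eq_fun do rewrite phiE; exact: integrable_normal_pdf. Qed.

Lemma Rintegral_phi th : \int[leb]_t phi (t - th) = 1.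
Proof.
rewrite /Rintegral; under eq_integral do rewrite phiE.
by rewrite integral_normal_pdf.
Qed.

Definition bounded_meas u :=
  measurable_fun setT u /\ exists M, forall t, `|u t| <= M.

Lemma bounded_meas_cst (a : R) : bounded_meas (fun=> a).
Proof. by split; [exact: measurable_cst|exists `|a|]. Qed.

Lemma bounded_measB u v : bounded_meas u -> bounded_meas v ->
  bounded_meas (fun t => u t - v t).
Proof.
move=> [mu [M uM]] [mv [N vN]]; split; first exact: measurable_funB.
by exists (M + N) => t; rewrite (le_trans (ler_normB _ _))// lerD.
Qed.

Lemma bounded_measM u v : bounded_meas u -> bounded_meas v ->
  bounded_meas (fun t => u t * v t).
Proof.
move=> [mu [M uM]] [mv [N vN]]; split; first exact: measurable_funM.
by exists (M * N) => t; rewrite normrM ler_pM.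
Qed.

Lemma bounded_meas_indic (A : set R) : measurable A -> bounded_meas \1_A.
Proof.
move=> mA; split; first exact: measurable_indic.
by exists 1 => t; rewrite indicE; case: (_ \in _); rewrite ?normr1 ?normr0.
Qed.

(** The expectation of [u Z] for [Z] normal with mean [th] and variance 1. *)
Definition gmean th u := \int[leb]_t (u t * phi (t - th)).

Lemma integrable_gmean th u : bounded_meas u ->
  leb.-integrable setT (EFin \o (fun t => u t * phi (t - th))).
Proof.
move=> [mu [M uM]].
apply: (@le_integrable _ (measurableTypeR R) _ leb setT measurableT _
  (fun t => M%:E * (phi (t - th))%:E)%E) => //.
- apply/measurable_EFinP; apply: measurable_funM => //; exact: measurable_phi.
- move=> t _; rewrite /= lee_fin !normrM ler_wpM2r//.
  by rewrite (le_trans (uM t))// ler_norm.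
- by apply: integrableZl => //; exact: integrable_phi.
Qed.

Lemma le_gmean th1 th2 u v : bounded_meas u -> bounded_meas v ->
  (forall t, u t * phi (t - th1) <= v t * phi (t - th2)) ->
  gmean th1 u <= gmean th2 v.
Proof.
by move=> bu bv uv; apply: le_Rintegral => //; exact: integrable_gmean.
Qed.

Lemma gmean_ge0 th u : (forall t, 0 <= u t) -> 0 <= gmean th u.
Proof. by move=> u0; apply: Rintegral_ge0 => t _; rewrite mulr_ge0 ?phi_ge0. Qed.

Lemma gmeanB th u v : bounded_meas u -> bounded_meas v ->
  gmean th (fun t => u t - v t) = gmean th u - gmean th v.
Proof.
move=> bu bv; rewrite -RintegralB//; [|exact: integrable_gmean..].
by apply: eq_Rintegral => t _; rewrite mulrBl.
Qed.

Lemma gmeanZ th (a : R) u : bounded_meas u ->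
  gmean th (fun t => a * u t) = a * gmean th u.
Proof.
move=> bu; rewrite -RintegralZl//; last exact: integrable_gmean.
by apply: eq_Rintegral => t _; rewrite mulrA.
Qed.

Lemma gmean1 th : gmean th (fun=> 1) = 1.
Proof. by rewrite -[RHS](Rintegral_phi th); apply: eq_Rintegral => t _; rewrite mul1r. Qed.

Lemma gmean_cst th a : gmean th (fun=> a) = a.
Proof.
have := gmeanZ th a _ (bounded_meas_cst 1); rewrite gmean1 mulr1.
by congr (gmean _ _ = _); apply/funext => t; rewrite mulr1.
Qed.

Lemma Rintegral_sum (I : Type) (s : seq I) (f : I -> R -> R) :
  (forall i, leb.-integrable setT (EFin \o f i)) ->
  leb.-integrable setT (EFin \o (fun t => \sum_(i <- s) f i t)) /\
  \int[leb]_t (\sum_(i <- s) f i t) = \sum_(i <- s) \int[leb]_t f i t.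
Proof.
move=> intf; elim: s => [|i s [IHi IHs]].
  have -> : (fun t => \sum_(i <- [::]) f i t) = fun=> 0.
    by apply/funext => t; rewrite big_nil.
  by split; [exact: integrable0|rewrite big_nil Rintegral_cst// mul0r].
have -> : (fun t => \sum_(j <- i :: s) f j t) =
    fun t => f i t + \sum_(j <- s) f j t.
  by apply/funext => t; rewrite big_cons.
split; first exact: (integrableD _ (intf i) IHi).
by rewrite RintegralD// IHs big_cons.
Qed.

Definition window (c : R) : R -> R := \1_(`[c, c + 1]%classic).

Lemma windowE c t : window c t = (c <= t <= c + 1)%R%:R.
Proof. by rewrite /window indicE mem_setE in_itv. Qed.

Lemma bounded_meas_window c : bounded_meas (window c).
Proof. exact: bounded_meas_indic. Qed.

Lemma window_ge0 c t : 0 <= window c t.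
Proof. by rewrite windowE. Qed.

Lemma integral_window c : (\int[leb]_t (window c t)%:E = 1)%E.
Proof.
rewrite integral_indic// setIT.
transitivity (lebesgue_measure [set` `[c, c + 1]]); first by [].
rewrite lebesgue_measure_itv/= lte_fin ltrDl ltr01 -EFinB.
by rewrite addrAC subrr add0r.
Qed.

Lemma integrable_window c : leb.-integrable setT (EFin \o window c).
Proof.
apply/integrableP; split.
  by apply/measurable_EFinP; exact: measurable_indic.
rewrite [X in (X < _)%E](_ : _ = \int[leb]_t (window c t)%:E)%E; last first.
  by apply: eq_integral => t _; rewrite /= ger0_norm ?window_ge0.
by rewrite integral_window ltry.
Qed.

Lemma Rintegral_window c : \int[leb]_t window c t = 1.
Proof.
by rewrite /Rintegral integral_window.
Qed.

Definition halfline (tau : R) : R -> R := \1_(`[tau, +oo[%classic).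

Lemma halflineE tau t : halfline tau t = (tau <= t)%R%:R.
Proof. by rewrite /halfline indicE mem_setE in_itv/= andbT. Qed.

Lemma bounded_meas_halfline tau : bounded_meas (halfline tau).
Proof. exact: bounded_meas_indic. Qed.

Lemma halfline_ge0 tau t : 0 <= halfline tau t.
Proof. by rewrite halflineE. Qed.

Lemma gmean_halflineC tau th :
  gmean th (fun t => 1 - halfline tau t) = 1 - gmean th (halfline tau).
Proof.
by rewrite gmeanB ?gmean1//; [exact: bounded_meas_cst|exact: bounded_meas_halfline].
Qed.

Lemma bounded_meas_halflineC tau : bounded_meas (fun t => 1 - halfline tau t).
Proof. by apply: bounded_measB; [exact: bounded_meas_cst|exact: bounded_meas_halfline]. Qed.

Lemma gmean_halfline_ge0 tau th : 0 <= gmean th (halfline tau).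
Proof. by apply: gmean_ge0 => t; exact: halfline_ge0. Qed.

Lemma gmean_halfline_le1 tau th : gmean th (halfline tau) <= 1.
Proof.
rewrite -subr_ge0 -gmean_halflineC; apply: gmean_ge0 => t.
by rewrite halflineE; case: (tau <= t); rewrite ?subr0 ?subrr.
Qed.

(** The two densities cross at the midpoint of [th1] and [th2]. If [tau] is beyond it, they are
    ordered on the whole half-line; otherwise they are ordered the other way on its complement. *)
Lemma le_gmean_halfline tau th1 th2 : th1 <= th2 ->
  gmean th1 (halfline tau) <= gmean th2 (halfline tau).
Proof.
move=> th12; have [mid|mid] := leP (th1 + th2) (2 * tau).
  apply: le_gmean => [||t].
  1,2: exact: bounded_meas_halfline.
  rewrite halflineE; case: (leP tau t) => [tt|_]; last by rewrite !mul0r.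
  rewrite !mul1r; apply: le_phi; nra.
rewrite -lerN2 -(lerD2l 1) -!gmean_halflineC.
apply: le_gmean => [||t].
1,2: exact: bounded_meas_halflineC.
rewrite halflineE; case: (leP tau t) => [_|tt]; first by rewrite subrr !mul0r.
by rewrite subr0 !mul1r; apply: le_phi; nra.
Qed.

(** The difference of densities is nonnegative beyond the midpoint [c + 2^-1], so only
    [[c + 1, c + 2]] is counted. There the density at [c] is at most [expR (- 1 / 2)] times the one
    at [c + 1], which is itself at least [phi 1]. *)
Lemma gmean_halfline_gap c :
  (1 - expR (- 1 / 2)) * phi 1 <=
  gmean (c + 1) (halfline (c + 2^-1)) - gmean c (halfline (c + 2^-1)).
Proof.
have bh := bounded_meas_halfline (c + 2^-1).
set e := _ * _.
have -> : e = \int[leb]_t (e * window (c + 1) t).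
  by rewrite RintegralZl ?Rintegral_window ?mulr1//; exact: integrable_window.
rewrite -RintegralB//; [|exact: integrable_gmean..].
have e1 : expR (- 1 / 2 : R) <= 1 by rewrite expR_le1; lra.
apply: le_Rintegral => //.
- exact: (integrableZl measurableT e (integrable_window (c + 1))).
- exact: (integrableB measurableT (integrable_gmean (c + 1) _ bh)
                                   (integrable_gmean c _ bh)).
move=> t _; rewrite windowE halflineE -mulrBr.
have [tt|tt] := leP (c + 2^-1) t; last first.
  rewrite mul0r (_ : (c + 1 <= t) = false) ?mulr0//.
  by apply/negbTE; rewrite -ltNge; lra.
rewrite mul1r; case: (boolP (c + 1 <= t <= c + 1 + 1)) => [|_]; last first.
  rewrite mulr0 subr_ge0; apply: le_phi; nra.
move=> /andP[t1 t2]; rewrite mulr1.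
have h1 : phi (t - c) <= expR (- 1 / 2) * phi (t - (c + 1)).
  by apply: phi_le_expR; nra.
have h2 : phi 1 <= phi (t - (c + 1)) by apply: le_phi; nra.
apply: (@le_trans _ _ ((1 - expR (- 1 / 2)) * phi (t - (c + 1)))).
  by rewrite ler_wpM2l// subr_ge0.
by rewrite mulrBl mul1r lerB.
Qed.

(** Change of measure: where [u] is nonzero, the density at [th] is at most [expR (- d / 2)] times
    the density at [c], whose total mass is 1. No Gaussian tail integral is evaluated. *)
Lemma gmean_far th c d u : bounded_meas u -> (forall t, 0 <= u t <= 1) ->
  (forall t, u t != 0 -> (t - c) ^+ 2 + d <= (t - th) ^+ 2) ->
  gmean th u <= expR (- d / 2).
Proof.
move=> bu u01 far; rewrite -(gmean_cst c (expR _)).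
apply: le_gmean => // [|t]; first exact: bounded_meas_cst.
have [->|u0] := eqVneq (u t) 0; first by rewrite mul0r mulr_ge0 ?expR_ge0 ?phi_ge0.
have /andP[_ u1] := u01 t.
apply: le_trans (phi_le_expR _ _ _ (far _ u0)).
by rewrite ler_piMl ?phi_ge0.
Qed.

End Gauss.

(** * One pair of points *)

Section FiniteSums.
Context {R : realType} {n : nat}.
Implicit Types (w th m f : 'I_n -> R).

Lemma sum_ge_pair f (a b : 'I_n) : a != b -> (forall p, 0 <= f p) ->
  f a + f b <= \sum_p f p.
Proof.
move=> ab f0; rewrite (bigD1 a)//= (bigD1 b) 1?eq_sym//= addrA lerDl.
exact: sumr_ge0.
Qed.

(** The two points of the pair cost at most 1 each, and all the others together at most [n%:R * e],
    hence at most 1. *)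
Lemma sum_le_pair f (a b : 'I_n) e : f a <= 1 -> f b <= 1 -> 0 <= e ->
  (forall p, p != a -> p != b -> f p <= e) -> n%:R * e <= 1 ->
  \sum_p f p <= 3.
Proof.
move=> fa fb e0 fe ne.
have h p : f p <= (p == a)%:R + (p == b)%:R + e.
  have [->|pa] := eqVneq p a.
    by rewrite (le_trans fa)// -addrA lerDl addr_ge0.
  have [->|pb] := eqVneq p b; first by rewrite (le_trans fb)// add0r lerDl.
  by rewrite !add0r fe.
apply: le_trans (ler_sum _ (fun p _ => h p)) _.
rewrite !big_split/= sumr_const card_ord.
have one (c : 'I_n) : \sum_(p < n) ((p == c)%:R : R) = 1.
  by rewrite (bigD1 c)//= eqxx big1 ?addr0// => p /negPf ->.
by rewrite !one -mulr_natl; lra.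
Qed.

(* Chebyshev's sum inequality: W^2 times the weighted covariance is
   1/2 sum_{p,q} w_p w_q (th_p - th_q) (m_p - m_q). *)
Lemma covariance_ge w th m (a b : 'I_n) : (forall p, 0 <= w p) -> a != b ->
  0 < w a ->
  (forall p q, 0 <= (th p - th q) * (m p - m q)) ->
  w a * w b * ((th b - th a) * (m b - m a)) / (\sum_p w p) <=
  \sum_p m p * ((th p - (\sum_q th q * w q) / (\sum_q w q)) * w p).
Proof.
move=> w0 ab wa mono; set W := \sum_p w p.
have W0 : 0 < W.
  by rewrite /W (bigD1 a)//= ltr_wpDr// sumr_ge0.
rewrite ler_pdivrMr//.
pose T p q := w p * w q * ((th p - th q) * (m p - m q)).
have T0 p q : 0 <= T p q by apply: mulr_ge0 => //; exact: mulr_ge0.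
have TS : \sum_p \sum_q T p q =
    2 * ((\sum_p m p * ((th p - (\sum_q th q * w q) / W) * w p)) * W).
  have e1 : (\sum_p m p * ((th p - (\sum_q th q * w q) / W) * w p)) * W =
      \sum_p \sum_q m p * (th p - th q) * w p * w q.
    rewrite [LHS]mulr_suml; apply: eq_bigr => p _.
    have -> : m p * ((th p - (\sum_q th q * w q) / W) * w p) * W =
        m p * w p * (th p * W - \sum_q th q * w q).
      by field; rewrite gt_eqF.
    rewrite /W mulr_sumr -sumrB mulr_sumr; apply: eq_bigr => q _; ring.
  rewrite e1 mulr_natl mulr2n [X in _ = _ + X]exchange_big/= -big_split/=.
  apply: eq_bigr => p _; rewrite -big_split/=; apply: eq_bigr => q _.
  rewrite /T; ring.
(* All [T p q] are nonnegative, so the double sum dominates its entries at [(a, b)] and [(b, a)]. *)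
have : T a b + T b a <= \sum_p \sum_q T p q.
  have Ts p q : T p q <= \sum_q0 T p q0.
    by rewrite (bigD1 q)//= lerDl sumr_ge0.
  apply: (le_trans (lerD (Ts a b) (Ts b a))).
  by apply: (sum_ge_pair (fun p => \sum_q T p q) a b ab) => p; exact: sumr_ge0.
rewrite TS; have -> : T a b + T b a = 2 * (w a * w b * ((th b - th a) * (m b - m a))).
  rewrite /T; ring.
by rewrite ler_pM2l.
Qed.

End FiniteSums.

(* On the window [w_a, w_b >= phi 1], the weights sum to at most 3, and the last
   factor bounds [m_b - m_a] by [gmean_halfline_gap]. *)
Definition kappa (R : realType) : R :=
  phi 1 * phi 1 * ((1 - expR (- 1 / 2)) * phi 1) / 3.

Lemma kappa_gt0 (R : realType) : 0 < kappa R.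
Proof.
have e1 : 0 < 1 - expR (- 1 / 2) :> R by rewrite subr_gt0 expR_lt1; lra.
rewrite /kappa; move: (phi 1) (phi_gt0 (1 : R)) => x x0.
by apply: divr_gt0 => //; apply: mulr_gt0; apply: mulr_gt0.
Qed.

(** The cross term of the square is dropped. Here [x] is a distance to the nearer reference point
    and [y] the additional distance to a far point; [z] is fixed only up to sign. *)
Lemma sqr_add_le (R : realType) (x y z d : R) : 0 <= x -> 0 <= d -> d <= y ->
  z ^+ 2 = (x + y) ^+ 2 -> x ^+ 2 + d ^+ 2 <= z ^+ 2.
Proof.
move=> x0 d0 dy ->; have y0 := le_trans d0 dy.
have : d ^+ 2 <= y ^+ 2 by rewrite ler_sqr.
have : 0 <= x * y by exact: mulr_ge0.
by rewrite sqrrD; lra.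
Qed.

(** * Tail indicators and the separable rule near one pair *)

Section Cluster.
Context {R : realType} {n : nat}.
Local Notation leb := (@lebesgue_measure R).
Variable ths : 'I_n -> R.

Definition sep_rule (t : R) : R :=
  (\sum_(k < n) ths k * phi (t - ths k)) / (\sum_(k < n) phi (t - ths k)).

Lemma sum_phi_ge0 t : 0 <= \sum_(k < n) phi (t - ths k).
Proof. by apply: sumr_ge0 => k _; exact: phi_ge0. Qed.

Lemma normr_sep_rule t : `|sep_rule t| <= \sum_k `|ths k|.
Proof.
rewrite normrM normfV (ger0_norm (sum_phi_ge0 t)).
(* The denominator vanishes only for [n = 0]; the quotient is then 0 by the convention for the
   inverse of 0. *)
have [->|W0] := eqVneq (\sum_(k < n) phi (t - ths k)) 0.
  by rewrite invr0 mulr0 sumr_ge0.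
have W1 : 0 < \sum_(k < n) phi (t - ths k) by rewrite lt0r W0 sum_phi_ge0.
rewrite ler_pdivrMr// (le_trans (ler_norm_sum _ _ _))// mulr_suml.
apply: ler_sum => k _; rewrite normrM ler_wpM2l// ger0_norm ?phi_ge0//.
by rewrite (bigD1 k)//= lerDl sumr_ge0// => j _; exact: phi_ge0.
Qed.

Lemma measurable_sep_rule : measurable_fun setT sep_rule.
Proof.
rewrite /sep_rule; apply: measurable_funM.
  apply: measurable_sum => k; apply: measurable_funM => //; exact: measurable_phi.
(* The inverse of a nonnegative function is its power -1, and powers are measurable. *)
under eq_fun do rewrite -powR_inv1 ?sum_phi_ge0//.
apply: (measurableT_comp (measurable_powR _)).
by apply: measurable_sum => k; exact: measurable_phi.
Qed.

Lemma bounded_meas_sep_rule : bounded_meas sep_rule.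
Proof.
by split; [exact: measurable_sep_rule|exists (\sum_k `|ths k|); exact: normr_sep_rule].
Qed.

Variables (c d : R) (a b : 'I_n).
Hypotheses (ab : a != b) (tha : ths a = c) (thb : ths b = c + 1).
Hypotheses (d0 : 0 <= d) (nd : n%:R * expR (- d ^+ 2 / 2) <= 1).
Hypothesis far : forall p, p != a -> p != b ->
  (ths p <= c - d) \/ (c + 1 + d <= ths p).

Definition tail : R -> R := halfline (c + 2^-1).
Definition tailp (p : 'I_n) : R := gmean (ths p) tail.
Definition tailvar (p : 'I_n) : R := gmean (ths p) (fun t => (tail t - tailp p) ^+ 2).

Lemma tailp_ge0 p : 0 <= tailp p. Proof. exact: gmean_halfline_ge0. Qed.
Lemma tailp_le1 p : tailp p <= 1. Proof. exact: gmean_halfline_le1. Qed.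

(** Bernoulli variance: [tail] takes only the values 0 and 1. *)
Lemma tailvarE p : tailvar p = tailp p * (1 - tailp p).
Proof.
have bh := bounded_meas_halfline (c + 2^-1).
rewrite /tailvar; have -> : (fun t => (tail t - tailp p) ^+ 2) =
    fun t => (1 - 2 * tailp p) * tail t - (- tailp p ^+ 2).
  apply/funext => t; rewrite /tail halflineE.
  by case: (c + 2^-1 <= t); rewrite ?mulr1n ?mulr0n; ring.
rewrite gmeanB; [|exact: bounded_measM (bounded_meas_cst _) bh|exact: bounded_meas_cst].
by rewrite gmeanZ// gmean_cst -/(tailp p); ring.
Qed.

(** A Bernoulli variance is at most either probability. For a point left of the pair the mass beyond
    the threshold is small, by comparison with [c]; for a point on the right the mass before it is,
    by comparison with [c + 1]. *)
Lemma tailvar_far p : p != a -> p != b -> tailvar p <= expR (- d ^+ 2 / 2).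
Proof.
move=> pa pb; rewrite tailvarE.
have [m0 m1] := (tailp_ge0 p, tailp_le1 p).
have [le|ge] := far p pa pb.
  apply: (@le_trans _ _ (tailp p)); first by rewrite ler_piMr// lerBlDr lerDl.
  apply: (gmean_far _ c) => [|t|t]; first exact: bounded_meas_halfline.
    by rewrite /tail halflineE; case: (c + 2^-1 <= t); rewrite lexx ler01.
  rewrite /tail halflineE; case: (leP (c + 2^-1) t); last by rewrite eqxx.
  by move=> tt _; apply: (@sqr_add_le _ _ (c - ths p)) => //; [lra|lra|ring].
apply: (@le_trans _ _ (1 - tailp p)); first by rewrite ler_piMl// subr_ge0.
rewrite -gmean_halflineC.
apply: (gmean_far _ (c + 1)) => [|t|t]; first exact: bounded_meas_halflineC.
  by rewrite halflineE; case: (c + 2^-1 <= t); rewrite ?subrr ?subr0 lexx ler01.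
rewrite halflineE; case: (leP (c + 2^-1) t); first by rewrite subrr eqxx.
move=> tt _; rewrite -[X in X + _]sqrrN.
by apply: (@sqr_add_le _ _ (ths p - (c + 1))) => //; [lra|lra|ring].
Qed.

Lemma sum_tailvar_le : \sum_p tailvar p <= 3.
Proof.
have v1 p : tailvar p <= 1.
  by rewrite tailvarE; have [m0 m1] := (tailp_ge0 p, tailp_le1 p); nra.
apply: (sum_le_pair _ a b (expR (- d ^+ 2 / 2))) => //.
exact: tailvar_far.
Qed.

Lemma sum_phi_window t : c <= t <= c + 1 -> \sum_(p < n) phi (t - ths p) <= 3.
Proof.
move=> /andP[t1 t2].
apply: (sum_le_pair _ a b (expR (- d ^+ 2 / 2))) => //.
1,2: exact: phi_le1.
move=> p pa pb; apply: (@le_trans _ _ (expR (- d ^+ 2 / 2) * phi 0)).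
  apply: phi_le_expR; have [h|h] := far p pa pb.
    by apply: (@sqr_add_le _ _ (t - ths p)) => //; [lra|rewrite add0r].
  by apply: (@sqr_add_le _ _ (ths p - t)) => //; [lra|ring].
by rewrite ler_piMr ?expR_ge0 ?phi_le1.
Qed.

(** The bound is [3 * 4]. The variances add up to at most 3 and the squared mean is at most 1, which
    gives 4; the densities sum to at most 3 on a window of length 1. *)
Lemma sum_window_le :
  \sum_p gmean (ths p) (window c) * (\sum_(q | q != p) tailvar q + tailp p ^+ 2)
    <= 12.
Proof.
have v0 q : 0 <= tailvar q by apply: gmean_ge0 => t; exact: sqr_ge0.
have u0 p : 0 <= gmean (ths p) (window c).
  by apply: gmean_ge0 => t; exact: window_ge0.
apply: (@le_trans _ _ (\sum_p gmean (ths p) (window c) * 4)).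
  apply: ler_sum => p _; rewrite ler_wpM2l//.
  have := sum_tailvar_le; rewrite (bigD1 p)//=.
  have := v0 p; have [m0 m1] := (tailp_ge0 p, tailp_le1 p).
  have : tailp p ^+ 2 <= 1 by rewrite expr_le1.
  lra.
rewrite -mulr_suml; suff : \sum_p gmean (ths p) (window c) <= 3 by lra.
have intw p := integrable_gmean (ths p) _ (bounded_meas_window c).
have [intS <-] := Rintegral_sum _ (index_enum 'I_n) _ intw.
have -> : (3 : R) = \int[leb]_t (3 * window c t).
  by rewrite RintegralZl ?Rintegral_window ?mulr1//; exact: integrable_window.
apply: le_Rintegral => //.
  exact: (integrableZl measurableT 3 (integrable_window c)).
move=> t _; rewrite -mulr_sumr mulrC windowE.
by case: (boolP (c <= t <= c + 1)) => [/sum_phi_window|]; rewrite ?mulr1 ?mulr0.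
Qed.

(** Pointwise on the window the sum is a covariance under the weights [phi (t - ths p)], as
    [sep_rule t] is the weighted mean of [ths]; [covariance_ge] keeps the pair alone. The window has
    length 1, so integration preserves the constant. *)
Lemma sum_signal_ge :
  kappa R <= - \sum_p tailp p * gmean (ths p) (fun t => window c t * (sep_rule t - ths p)).
Proof.
have bu p : bounded_meas (fun t => window c t * (sep_rule t - ths p)).
  apply: bounded_measM; first exact: bounded_meas_window.
  by apply: bounded_measB; [exact: bounded_meas_sep_rule|exact: bounded_meas_cst].
have bu' p : bounded_meas (fun t => - tailp p * (window c t * (sep_rule t - ths p))).
  by apply: bounded_measM => //; exact: bounded_meas_cst.
rewrite -sumrN; under eq_bigr do rewrite -mulNr -gmeanZ//.
have intw p := integrable_gmean (ths p) _ (bu' p).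
have [intS <-] := Rintegral_sum _ (index_enum 'I_n) _ intw.
have -> : kappa R = \int[leb]_t (kappa R * window c t).
  by rewrite RintegralZl ?Rintegral_window ?mulr1//; exact: integrable_window.
apply: le_Rintegral => //.
  exact: (integrableZl measurableT (kappa R) (integrable_window c)).
move=> t _.
have -> : \sum_p - tailp p * (window c t * (sep_rule t - ths p)) * phi (t - ths p) =
    (\sum_p tailp p * ((ths p - sep_rule t) * phi (t - ths p))) * window c t.
  by rewrite mulr_suml; apply: eq_bigr => p _; ring.
rewrite windowE; case: (boolP (c <= t <= c + 1)) => [tw|]; last by rewrite !mulr0.
rewrite !mulr1.
have mono p q : 0 <= (ths p - ths q) * (tailp p - tailp q).
  have [pq|/ltW pq] := leP (ths p) (ths q).
    by rewrite mulr_le0// subr_le0// le_gmean_halfline.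
  by rewrite mulr_ge0// subr_ge0// le_gmean_halfline.
have w0 p : 0 <= phi (t - ths p) by exact: phi_ge0.
apply: (le_trans _ (covariance_ge (fun p => phi (t - ths p)) ths tailp a b w0 ab
  (phi_gt0 _) mono)).
have /andP[t1 t2] := tw.
have W3 := sum_phi_window t tw.
have W0 : 0 < \sum_(p < n) phi (t - ths p).
  rewrite (bigD1 a)//=; apply: ltr_wpDr; last exact: phi_gt0.
  by apply: sumr_ge0 => p _; exact: phi_ge0.
have e1 : expR (- 1 / 2 : R) <= 1 by rewrite expR_le1; lra.
have g0 : 0 <= (1 - expR (- 1 / 2)) * phi (1 : R).
  by rewrite mulr_ge0 ?phi_ge0 ?subr_ge0.
apply: (@le_trans _ _ (phi 1 * phi 1 * ((1 - expR (- 1 / 2)) * phi 1)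
                       / \sum_(p < n) phi (t - ths p))).
  by rewrite /kappa ler_wpM2l ?lef_pV2 ?posrE// !mulr_ge0 ?phi_ge0 ?subr_ge0.
rewrite ler_wpM2r ?invr_ge0 ?(ltW W0)//; apply: ler_pM => //.
- by rewrite mulr_ge0 ?phi_ge0.
- by apply: ler_pM; rewrite ?phi_ge0//; apply: le_phi; rewrite ?tha ?thb; nra.
- rewrite thb tha /tailp thb tha (_ : c + 1 - c = 1); last by ring.
  by rewrite mul1r; exact: gmean_halfline_gap.
Qed.

End Cluster.

(** * Means of products over independent coordinates *)

Section Mean.
Context {R : realType} {n : nat}.
Local Notation leb := (@lebesgue_measure R).
Variables (ths : 'I_n -> R) (s : {perm 'I_n}).
Implicit Types (f : (nat -> R) -> R) (u w : R -> R) (i j l : 'I_n).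

(** Conditional expectation of [f X] given that the permutation is [s], including integrability at
    each stage. *)
Definition has_mean f (v : R) : Prop :=
  is_iint n (fun x => f x * lik ths s x) (fun=> v).

Lemma has_mean_ext f1 f2 v1 v2 : f1 =1 f2 -> v1 = v2 ->
  has_mean f1 v1 -> has_mean f2 v2.
Proof. by move=> /funext -> ->. Qed.

Lemma has_meanD f1 f2 v1 v2 : has_mean f1 v1 -> has_mean f2 v2 ->
  has_mean (fun x => f1 x + f2 x) (v1 + v2).
Proof.
move=> h1 h2; rewrite /has_mean; under eq_fun do rewrite mulrDl.
exact: is_iintD h1 h2.
Qed.

Lemma has_meanZ a f v : has_mean f v -> has_mean (fun x => a * f x) (a * v).
Proof.
move=> h; rewrite /has_mean; under eq_fun do rewrite -mulrA.
exact: is_iintZ h.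
Qed.

Lemma has_mean_sum (I : Type) (r : seq I) (P : pred I)
    (f : I -> (nat -> R) -> R) (v : I -> R) :
  (forall k, P k -> has_mean (f k) (v k)) ->
  has_mean (fun x => \sum_(k <- r | P k) f k x) (\sum_(k <- r | P k) v k).
Proof.
move=> h; rewrite /has_mean; under eq_fun do rewrite mulr_suml.
exact: (is_iint_sum _ _ _ _ (fun k x => f k x * lik ths s x) (fun k => fun=> v k) h).
Qed.

Lemma has_mean_prod (F : 'I_n -> R -> R) :
  (forall j, bounded_meas (F j)) ->
  has_mean (fun x => \prod_(j < n) F j (x j))
           (\prod_(j < n) gmean (ths (s j)) (F j)).
Proof.
move=> bF; rewrite /has_mean /lik; under eq_fun do rewrite -big_split/=.
exact: (is_iint_prodT _ (fun j t => F j t * phi (t - ths (s j)))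
         (fun j => integrable_gmean _ _ (bF j))).
Qed.

(** Padding with the constant 1 turns a function of one coordinate into a product over all
    coordinates, whose mean factors. *)
Let at_coord i u : 'I_n -> R -> R := fun j t => if j == i then u t else 1.

Let prod_at_coord i u (x : nat -> R) : \prod_(j < n) at_coord i u j (x j) = u (x i).
Proof.
rewrite (bigD1 i)//= /at_coord eqxx big1 ?mulr1// => j.
by move/negPf ->.
Qed.

Let bounded_at_coord i u j : bounded_meas u -> bounded_meas (at_coord i u j).
Proof.
by rewrite /at_coord; case: (j == i) => // _; exact: bounded_meas_cst.
Qed.

Lemma has_mean_coord i u : bounded_meas u ->
  has_mean (fun x => u (x i)) (gmean (ths (s i)) u).
Proof.
move=> bu.
apply: has_mean_ext (has_mean_prod _ (fun j => bounded_at_coord i u j bu)).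
  by move=> x; exact: prod_at_coord.
rewrite (bigD1 i)//= {1}/at_coord eqxx big1 ?mulr1// => j ji.
by rewrite /at_coord (negPf ji) gmean1.
Qed.

Lemma has_mean_coord2 i j u (v : R -> R) : i != j -> bounded_meas u -> bounded_meas v ->
  has_mean (fun x => u (x i) * v (x j))
    (gmean (ths (s i)) u * gmean (ths (s j)) v).
Proof.
move=> ij bu bv.
have bF k := bounded_measM _ _ (bounded_at_coord i u k bu) (bounded_at_coord j v k bv).
apply: has_mean_ext (has_mean_prod _ bF).
  by move=> x; rewrite big_split/= !prod_at_coord.
rewrite (bigD1 i)//= (bigD1 j) 1?eq_sym//= /at_coord !eqxx (negPf ij).
rewrite [j == i]eq_sym (negPf ij) big1 ?mulr1 => [|k /andP[/negPf -> /negPf ->]].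
  by congr (_ * _); congr gmean; apply/funext => t; rewrite ?mulr1 ?mul1r.
by under eq_fun do rewrite mulr1; rewrite gmean1.
Qed.

(** Coordinate [l] occurs in [w] alone, so the factored mean contains the vanishing mean of [w]. *)
Lemma has_mean_coord3_0 i j l u (v : R -> R) w : l != i -> l != j ->
  bounded_meas u -> bounded_meas v -> bounded_meas w ->
  gmean (ths (s l)) w = 0 ->
  has_mean (fun x => u (x i) * (v (x j) * w (x l))) 0.
Proof.
move=> li lj bu bv bw w0.
have bF k := bounded_measM _ _ (bounded_at_coord i u k bu)
  (bounded_measM _ _ (bounded_at_coord j v k bv) (bounded_at_coord l w k bw)).
apply: has_mean_ext (has_mean_prod _ bF).
  by move=> x; rewrite !big_split/= !prod_at_coord.
rewrite (bigD1 l)//= /at_coord eqxx (negPf li) (negPf lj).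
rewrite (_ : (fun t => _) = w) ?w0 ?mul0r//.
by apply/funext => t; rewrite !mul1r.
Qed.

(* The minorant [2 slope g y - slope^2 g^2] of [y^2], localised to a window, with
   [PI_i] already replaced by [ths (s i)] in [y = S_i - PI_i]. *)
Definition test_term (slope c : R) (i : 'I_n) (x : nat -> R) : R :=
  let g := \sum_(j | j != i) tail c (x j) - \sum_q tailp ths c q in
  window c (x i) * (2 * slope * g * (sep_rule ths (x i) - ths (s i)) - slope ^+ 2 * g ^+ 2).

(** Given the permutation, with [p = s i], the statistic [g] is independent of coordinate [i], has
    mean [- tailp ths c p], and its second moment is the last bracket: variance plus squared
    mean. *)
Definition test_mean (slope c : R) (p : 'I_n) : R :=
  2 * slope * - (tailp ths c p * gmean (ths p) (fun t => window c t * (sep_rule ths t - ths p)))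
  - slope ^+ 2 * (gmean (ths p) (window c) *
      (\sum_(q | q != p) tailvar ths c q + tailp ths c p ^+ 2)).

Lemma has_mean_test_term slope c i :
  has_mean (test_term slope c i) (test_mean slope c (s i)).
Proof.
pose m := tailp ths c (s i).
(* Centring each indicator gives [g] as the sum of the [psi j (x j)] over [j != i], minus [m]. The
   facts [A1], [A2] serve the linear term in [g], and [B1], [B2], [B3] the quadratic one. *)
pose psi j t := tail c t - tailp ths c (s j).
pose u1 t := window c t * (sep_rule ths t - ths (s i)).
have bu0 := bounded_meas_window c.
have bu1 : bounded_meas u1.
  apply: bounded_measM => //.
  by apply: bounded_measB; [exact: bounded_meas_sep_rule|exact: bounded_meas_cst].
have bpsi j : bounded_meas (psi j).
  by apply: bounded_measB; [exact: bounded_meas_halfline|exact: bounded_meas_cst].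
have psi0 j : gmean (ths (s j)) (psi j) = 0.
  rewrite gmeanB ?gmean_cst ?subrr//; last exact: bounded_meas_cst.
  exact: bounded_meas_halfline.
have A1 : has_mean (fun x => \sum_(j | j != i) u1 (x i) * psi j (x j)) 0.
  apply: has_mean_ext (has_mean_sum _ _ _ _ (fun=> 0) _) => //; first exact: big1.
  move=> j ji; rewrite -(mulr0 (gmean (ths (s i)) u1)) -(psi0 j).
  by apply: has_mean_coord2 => //; rewrite eq_sym.
have A2 := has_mean_coord i u1 bu1.
have B2 : has_mean (fun x => \sum_(j | j != i) window c (x i) * psi j (x j)) 0.
  apply: has_mean_ext (has_mean_sum _ _ _ _ (fun=> 0) _) => //; first exact: big1.
  move=> j ji; rewrite -(mulr0 (gmean (ths (s i)) (window c))) -(psi0 j).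
  by apply: has_mean_coord2 => //; rewrite eq_sym.
have B3 := has_mean_coord i (window c) bu0.
(* Off-diagonal products of centred factors have mean zero, so only [l = j] survives and yields a
   variance. *)
have B1 : has_mean (fun x => \sum_(j | j != i) \sum_(l | l != i)
      window c (x i) * (psi j (x j) * psi l (x l)))
    (\sum_(j | j != i) gmean (ths (s i)) (window c) * tailvar ths c (s j)).
  apply: has_mean_sum => j ji.
  apply: has_mean_ext (has_mean_sum _ _ _ _
    (fun l => if l == j then gmean (ths (s i)) (window c) * tailvar ths c (s j) else 0) _) => //.
    rewrite (bigD1 j)//= eqxx big1 ?addr0// => l /andP[_ /negPf ->//].
  move=> l li; have [->|lj] := eqVneq l j; last first.
    by apply: has_mean_coord3_0 => //; exact: psi0.
  apply: (has_mean_coord2 i j (window c) (fun t => psi j t * psi j t)) => //.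
    by rewrite eq_sym.
  exact: bounded_measM.
have := has_meanD _ _ _ _
  (has_meanD _ _ _ _ (has_meanZ (2 * slope) _ _ A1) (has_meanZ (- (2 * slope * m)) _ _ A2))
  (has_meanZ (- slope ^+ 2) _ _ (has_meanD _ _ _ _ B1
    (has_meanD _ _ _ _ (has_meanZ (- (2 * m)) _ _ B2) (has_meanZ (m ^+ 2) _ _ B3)))).
apply: has_mean_ext.
- move=> x; rewrite /test_term.
  (* A permutation uses every point exactly once, so the total of the [tailp] can be reindexed by
     [s]; removing [j = i] leaves [- m]. *)
  have -> : \sum_(j | j != i) tail c (x j) - \sum_q tailp ths c q =
      \sum_(j | j != i) psi j (x j) - m.
    rewrite [X in _ - X = _](reindex_inj (@perm_inj _ s)) [X in _ - X = _](bigD1 i)//=.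
    by rewrite sumrB /m; ring.
  have -> : \sum_(j | j != i) \sum_(l | l != i)
      window c (x i) * (psi j (x j) * psi l (x l)) =
      window c (x i) * (\sum_(j | j != i) psi j (x j)) ^+ 2.
    rewrite expr2 mulr_suml mulr_sumr; apply: eq_bigr => j _.
    by rewrite !mulr_sumr.
  by rewrite -!mulr_sumr /u1; ring.
- rewrite /test_mean -/m -mulr_sumr.
  have -> : \sum_(q | q != s i) tailvar ths c q =
      \sum_(j | j != i) tailvar ths c (s j).
    rewrite (reindex_inj (@perm_inj _ s))/=.
    by apply: eq_bigl => j; rewrite (inj_eq perm_inj).
  by rewrite /u1; ring.
Qed.

End Mean.

(** * Lower bound on the risk gap *)

Section RiskGap.
Context {R : realType} {n : nat}.
Variable ths : 'I_n -> R.

Definition gap_integrand (s : {perm 'I_n}) (x : nat -> R) : R :=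
  (\sum_(i < n) (est_S ths i x - est_PI ths i x) ^+ 2) * lik ths s x.

Lemma lik_gt0 s x : 0 < lik ths s x.
Proof. by apply: prodr_gt0 => j _; exact: phi_gt0. Qed.

Lemma sum_lik_ge0 x : 0 <= \sum_(s : {perm 'I_n}) lik ths s x.
Proof. by apply: sumr_ge0 => s _; exact: ltW (lik_gt0 s x). Qed.

Lemma sum_lik_gt0 x : 0 < \sum_(s : {perm 'I_n}) lik ths s x.
Proof.
rewrite (bigD1 1%g)//=; apply: ltr_wpDr; last exact: lik_gt0.
by apply: sumr_ge0 => s _; exact: ltW (lik_gt0 s x).
Qed.

Lemma gap_integrand_ge0 s x : 0 <= gap_integrand s x.
Proof.
apply: mulr_ge0; last exact: ltW (lik_gt0 s x).
by apply: sumr_ge0 => i _; exact: sqr_ge0.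
Qed.

Lemma measurable_gap_integrand s : coord_measurable (fun x => (gap_integrand s x)%:E).
Proof.
move=> d T g mg; apply/measurable_EFinP.
have mphi j c : measurable_fun setT (fun t => phi (g t j - c)).
  exact: (measurableT_comp (measurable_phi c) (mg j)).
have mlik s' : measurable_fun setT (fun t => lik ths s' (g t)).
  by apply: measurable_prod => j _; exact: mphi.
have mS i : measurable_fun setT (fun t => est_S ths i (g t)).
  exact: (measurableT_comp (measurable_sep_rule ths) (mg i)).
have mPI i : measurable_fun setT (fun t => est_PI ths i (g t)).
  rewrite /est_PI; apply: measurable_funM.
    by apply: measurable_sum => s'; apply: measurable_funM.
  under eq_fun do rewrite -powR_inv1 ?sum_lik_ge0//.
  apply: (measurableT_comp (measurable_powR _)).
  exact: measurable_sum.
apply: measurable_funM => //; apply: measurable_sum => i.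
by apply: measurable_funX; exact: measurable_funB.
Qed.

(** The tower property in unnormalised form. *)
Lemma sum_est_PI_lik i x :
  \sum_(s : {perm 'I_n}) ths (s i) * lik ths s x =
  est_PI ths i x * \sum_(s : {perm 'I_n}) lik ths s x.
Proof. by rewrite /est_PI divfK// gt_eqF ?sum_lik_gt0. Qed.

Variables (K : nat) (c : 'I_K -> R) (slope : R).
Hypothesis sumc : forall t, \sum_(k < K) window (c k) t <= 1.

(* Averaging over [s] turns [ths (s i)] into the permutation-invariant rule. *)
Lemma sum_test_term_le x :
  \sum_(s : {perm 'I_n})
     (\sum_(k < K) \sum_(i < n) test_term ths s slope (c k) i x) * lik ths s x
  <= \sum_(s : {perm 'I_n}) gap_integrand s x.
Proof.
set L := \sum_(s : {perm 'I_n}) lik ths s x.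
pose g k i := \sum_(j < n | j != i) tail (c k) (x j) - \sum_q tailp ths (c k) q.
pose A i := est_S ths i x - est_PI ths i x.
have -> : \sum_(s : {perm 'I_n}) gap_integrand s x = (\sum_(i < n) A i ^+ 2) * L.
  by rewrite mulr_sumr.
have -> : \sum_(s : {perm 'I_n})
     (\sum_(k < K) \sum_(i < n) test_term ths s slope (c k) i x) * lik ths s x =
  (\sum_(k < K) \sum_(i < n) window (c k) (x i) *
     (2 * slope * g k i * A i - slope ^+ 2 * g k i ^+ 2)) * L.
  under eq_bigr do rewrite mulr_suml.
  rewrite exchange_big/= mulr_suml; apply: eq_bigr => k _.
  under eq_bigr do rewrite mulr_suml.
  rewrite exchange_big/= mulr_suml; apply: eq_bigr => i _.
  transitivity (\sum_(s : {perm 'I_n})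
    (window (c k) (x i) * (2 * slope * g k i * est_S ths i x - slope ^+ 2 * g k i ^+ 2)
      * lik ths s x - window (c k) (x i) * (2 * slope * g k i) * (ths (s i) * lik ths s x))).
    by apply: eq_bigr => s _; rewrite /test_term -/(g k i); rewrite /est_S /sep_rule; ring.
  by rewrite sumrB -!mulr_sumr sum_est_PI_lik -/L /A; ring.
rewrite ler_wpM2r ?sum_lik_ge0//.
apply: (@le_trans _ _ (\sum_(k < K) \sum_(i < n) window (c k) (x i) * A i ^+ 2)).
  apply: ler_sum => k _; apply: ler_sum => i _; rewrite ler_wpM2l ?window_ge0//.
  (* The quadratic minorant is the expansion of this square. *)
  have := sqr_ge0 (A i - slope * g k i); rewrite sqrrB exprMn; lra.
(* By [sumc], each squared difference is charged with total weight at most 1 over all pairs. *)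
rewrite exchange_big/=; apply: ler_sum => i _; rewrite -mulr_suml.
by rewrite ler_piMl ?sqr_ge0.
Qed.

Variable v : R.
Hypothesis test_mean_ge : forall k, v <= \sum_p test_mean ths slope (c k) p.

Lemma risk_gap_ge : ((K%:R * v)%:E <= risk_gap ths)%E.
Proof.
have iT : is_iint n (fun x => \sum_(s : {perm 'I_n})
     (\sum_(k < K) \sum_(i < n) test_term ths s slope (c k) i x) * lik ths s x)
    (fun=> \sum_(s : {perm 'I_n}) \sum_(k < K) \sum_(i < n)
       test_mean ths slope (c k) (s i)).
  apply: (is_iint_sum _ _ _ _ _ (fun (s : {perm 'I_n}) (_ : nat -> R) =>
    \sum_(k < K) \sum_(i < n) test_mean ths slope (c k) (s i))) => s _.
  apply: has_mean_sum => k _; apply: has_mean_sum => i _.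
  exact: has_mean_test_term.
have le : ((n`!%:R * (K%:R * v))%:E <=
    \sum_(s : {perm 'I_n}) integral_Rn n (fun x => (gap_integrand s x)%:E))%E.
  rewrite /integral_Rn -iter_int_sum; first last.
    exact: measurable_gap_integrand.
    by move=> s y; rewrite lee_fin gap_integrand_ge0.
  (* The pointwise bound holds only after summing over permutations, hence the sum was first moved
     inside the integral. *)
  have := le_iter_int n _ _ (fun=> 0) (fun x => sum_test_term_le x : (_%:E <= _%:E)%E).
  rewrite (is_iint_iter_int _ _ _ _ iT) => le1.
  under [X in iter_int n X]eq_fun do rewrite sumEFin.
  apply: le_trans le1; rewrite lee_fin -card_Sn.
  have -> : #|{perm 'I_n}|%:R * (K%:R * v) = \sum_(s : {perm 'I_n}) \sum_(k < K) v.
    by rewrite !sumr_const card_ord -[RHS]mulr_natl -[v *+ K]mulr_natl.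
  apply: ler_sum => s _; apply: ler_sum => k _.
  apply: (le_trans (test_mean_ge k)).
  (* Summing over [i] makes the mean the same for every permutation, which matches the factor
     [n!]. *)
  by rewrite [leLHS](reindex_inj (@perm_inj _ s)).
have f0 : 0 < (n`!%:R : R) by rewrite ltr0n fact_gt0.
rewrite /risk_gap -(lee_pmul2l _ (x := n`!%:R%:E))//.
by rewrite muleA -!EFinM divff ?gt_eqF// mul1e.
Qed.

End RiskGap.

(** * The configuration of pairs *)

Lemma sum_window_le1 (R : realType) K (c : 'I_K -> R) :
  (forall k k' : 'I_K, (k < k')%N -> c k + 1 < c k') ->
  forall t, \sum_(k < K) window (c k) t <= 1.
Proof.
move=> sepc t.
have [[k kt]|nt] := pselect (exists k, c k <= t <= c k + 1); last first.
  rewrite big1 ?ler01// => k _; rewrite windowE.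
  by case: (boolP (c k <= t <= c k + 1)) => // kt; case: nt; exists k.
rewrite (bigD1 k)//= big1 => [|k' kk']; first by rewrite addr0 windowE lern1 leq_b1.
rewrite windowE; apply/eqP; rewrite pnatr_eq0 eqb0; apply/negP => k't.
have : (k' < k)%N || (k < k')%N by rewrite -neq_ltn.
by case/orP => /sepc; lra.
Qed.

(** Signal at least [kappa R] and quadratic term at most 12 give
    [2 * slope * kappa R - 12 * slope ^+ 2], which is maximal at [slope = kappa R / 12]. *)
Lemma sum_test_mean_ge (R : realType) n (ths : 'I_n -> R) (c d : R) (a b : 'I_n) :
  a != b -> ths a = c -> ths b = c + 1 -> 0 <= d ->
  n%:R * expR (- d ^+ 2 / 2) <= 1 ->
  (forall p, p != a -> p != b -> ths p <= c - d \/ c + 1 + d <= ths p) ->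
  kappa R ^+ 2 / 12 <= \sum_p test_mean ths (kappa R / 12) c p.
Proof.
move=> ab tha thb d0 nd far.
have h1 := sum_signal_ge ths c d a b ab tha thb d0 nd far.
have h2 := sum_window_le ths c d a b d0 nd far.
have k0 := kappa_gt0 R.
rewrite /test_mean sumrB -!mulr_sumr sumrN.
move: h1 h2; set X := - _; set Y := \sum_p _ => h1 h2.
have s0 : 0 <= kappa R / 12 by lra.
have e1 : kappa R / 12 * (kappa R / 12) * Y <= kappa R / 12 * (kappa R / 12) * 12.
  by rewrite ler_wpM2l// mulr_ge0.
have e2 : kappa R / 12 * kappa R <= kappa R / 12 * X.
  by rewrite ler_wpM2l.
rewrite !expr2; lra.
Qed.

Section Construction.
Context {R : realType}.
Variables (n K : nat) (mu L : R).

(** The pairs start at 0, so the surplus points at [- mu] are at distance at least [mu] from all of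
    them. *)
Definition pairs (i : 'I_n) : R :=
  if (i./2 < K)%N then (i./2)%:R * L + (odd i)%:R else - mu.

Hypothesis Kn : (K.*2 <= n)%N.

Lemma pairs_bound i : 1 <= L -> K%:R * L <= mu -> - mu <= pairs i <= mu.
Proof.
move=> L1 KL.
have K0 : 0 <= K%:R * L by rewrite mulr_ge0//; lra.
have mu0 : 0 <= mu by exact: le_trans KL.
rewrite /pairs; case: ifPn => iK; last by rewrite lexx/=; lra.
have h1 : 0 <= (i./2)%:R * L by rewrite mulr_ge0//; lra.
have h2 : (i./2.+1)%:R * L <= K%:R * L by rewrite ler_wpM2r ?ler_nat//; lra.
rewrite -natr1 mulrDl mul1r in h2.
by case: (odd i); rewrite ?mulr1n ?mulr0n; apply/andP; split; lra.
Qed.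

Lemma ltn_doubleS (k : 'I_K) : (k.*2.+1 < n)%N.
Proof. by apply: leq_trans Kn; rewrite -doubleS leq_double. Qed.

Lemma ltn_double (k : 'I_K) : (k.*2 < n)%N.
Proof. exact: ltnW (ltn_doubleS k). Qed.

Definition pair_lo k : 'I_n := Ordinal (ltn_double k).
Definition pair_hi k : 'I_n := Ordinal (ltn_doubleS k).

Lemma pairs_lo k : pairs (pair_lo k) = k%:R * L.
Proof. by rewrite /pairs/= doubleK ltn_ord odd_double addr0. Qed.

Lemma pairs_hi k : pairs (pair_hi k) = k%:R * L + 1.
Proof. by rewrite /pairs/= uphalf_double ltn_ord odd_double. Qed.

(** The critical neighbours are the upper point of pair [k - 1] and the lower point of pair [k + 1],
    both cleared by [d + 1 <= L]; surplus points are cleared by [d <= mu]. *)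
Lemma pairs_far d k p : 1 <= L -> d + 1 <= L -> d <= mu ->
  p != pair_lo k -> p != pair_hi k ->
  pairs p <= k%:R * L - d \/ k%:R * L + 1 + d <= pairs p.
Proof.
move=> L1 dL dmu nlo nhi; rewrite /pairs; case: ifPn => pK; last first.
  by left; have : 0 <= k%:R * L by [rewrite mulr_ge0//; lra]; lra.
have pk : p./2 != k.
  apply/negP => /eqP pk; move: nlo nhi; rewrite -!val_eqE/= -pk.
  by have := odd_double_half p; case: (odd p) => /= e; lia.
have o1 : 0 <= ((odd p)%:R : R) <= 1 by rewrite ler0n lern1 leq_b1.
move: pk; rewrite neq_ltn => /orP[pk|kp]; [left|right].
  have : (p./2.+1)%:R * L <= k%:R * L by rewrite ler_wpM2r ?ler_nat//; lra.
  by rewrite -natr1 mulrDl mul1r; lra.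
have : (k.+1)%:R * L <= (p./2)%:R * L by rewrite ler_wpM2r ?ler_nat//; lra.
by rewrite -natr1 mulrDl mul1r; lra.
Qed.

Lemma risk_gap_pairs d : 0 <= d -> d + 1 <= L -> 1 < L -> d <= mu ->
  n%:R * expR (- d ^+ 2 / 2) <= 1 ->
  ((K%:R * (kappa R ^+ 2 / 12))%:E <= risk_gap pairs)%E.
Proof.
move=> d0 dL L1 dmu nd.
apply: (risk_gap_ge _ _ (fun k : 'I_K => k%:R * L) (kappa R / 12)).
  apply: sum_window_le1 => k k' kk'.
  (* Windows are closed, so their disjointness uses the strict inequality [1 < L]. *)
  have : (k.+1)%:R * L <= k'%:R * L by rewrite ler_wpM2r ?ler_nat//; lra.
  by rewrite -natr1 mulrDl mul1r; lra.
move=> k; apply: (sum_test_mean_ge _ _ _ _ d (pair_lo k) (pair_hi k)) => //.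
- by rewrite -val_eqE/= neq_ltn leqnn.
- exact: pairs_lo.
- exact: pairs_hi.
- by move=> p; apply: pairs_far => //; exact: ltW.
Qed.

End Construction.

(** From [1 - ln n <= n^-1 <= 2^-1]. It ensures [l > 2^-1] below, so that spacing [4 * l] leaves
    room for the margin [2 * l] and the unit gap. *)
Lemma ln_nat_ge (R : realType) n : (2 <= n)%N -> 2^-1 <= ln (n%:R : R).
Proof.
move=> n2; have n0 : 0 < (n%:R : R) by rewrite ltr0n; lia.
have := expR_ge1Dx (- ln (n%:R : R)); rewrite expRN lnK ?posrE//.
have : n%:R^-1 <= (2^-1 : R) by rewrite lef_pV2 ?posrE ?ler_nat//.
lra.
Qed.

Lemma leq_half_mul4 n : (2 <= n)%N -> (n <= n./2 * 4)%N.
Proof. lia. Qed.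

Theorem theorem7 (R : realType) :
  exists (n0 : nat) (c : R), (0 < n0)%N /\ 0 < c /\
  forall (n : nat) (mu : R), (n0 <= n)%N ->
    8 * Num.sqrt (ln (n%:R : R)) <= mu ->
    exists ths : 'I_n -> R,
      (forall i, - mu <= ths i <= mu) /\
      ((c * Num.min (mu / Num.sqrt (ln (n%:R : R))) (n%:R : R))%:E
         <= risk_gap ths)%E.
Proof.
have k0 := kappa_gt0 R.
(* Here [96 = 12 * 8]: each pair yields [kappa R ^+ 2 / 12], and the minimum is at most [8 * K]. *)
exists 2%N, (kappa R ^+ 2 / 96); split=> //; split.
  by rewrite divr_gt0// exprn_gt0.
move=> n mu n2 muge; have lnn := ln_nat_ge R _ n2.
set l := Num.sqrt (ln (n%:R : R)) in muge *.
have l2 : l ^+ 2 = ln (n%:R : R) by rewrite sqr_sqrtr//; lra.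
have l0 : 0 <= l by exact: sqrtr_ge0.
have l1 : 2^-1 < l by nra.
have n0 : 0 < (n%:R : R) by rewrite ltr0n; exact: ltnW.
(* [y] counts the spacings [4 * l] that fit into [[0, mu]]; having two points per pair caps their
   number at [n./2]. *)
pose y := mu / (4 * l); pose K := minn (Num.truncn y) n./2.
have y2 : 2 <= y by rewrite ler_pdivlMr; lra.
have /andP[ty1 ty2] := truncn_itv (le_trans (ler0n _ 2) y2).
have yl : y * (4 * l) = mu by rewrite divfK// gt_eqF//; lra.
exists (@pairs R n K mu (4 * l)).
have Kn : (K.*2 <= n)%N by rewrite -geq_half_double geq_minr.
have KL : K%:R * (4 * l) <= mu.
  rewrite -yl ler_wpM2r//; first lra.
  by apply: le_trans ty1; rewrite ler_nat geq_minl.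
split; first by move=> i; apply: pairs_bound => //; lra.
(* The margin [2 * l] makes the exponential equal to [n^-2], so the product is [n^-1]. *)
have nd : n%:R * expR (- (2 * l) ^+ 2 / 2) <= 1.
  have -> : - (2 * l) ^+ 2 / 2 = - ln (n%:R : R) + - ln (n%:R : R).
    by rewrite exprMn l2; field.
  rewrite expRD expRN lnK ?posrE// mulrA divff ?gt_eqF// mul1r invf_le1//.
  by rewrite ler1n; exact: ltnW.
have d0 : 0 <= 2 * l by rewrite mulr_ge0.
have dL : 2 * l + 1 <= 4 * l by lra.
have L1 : 1 < 4 * l by lra.
have dmu : 2 * l <= mu by lra.
apply: le_trans (risk_gap_pairs n K mu (4 * l) Kn (2 * l) d0 dL L1 dmu nd).
rewrite lee_fin.
(* If [K] is the truncation of [y], then [2 <= y] gives [y <= 2 * K], while [mu / l = 4 * y]. If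
   [K = n./2], then already [n <= 4 * K]. *)
have KM : Num.min (mu / l) (n%:R : R) <= 8 * K%:R.
  rewrite ge_min /K; case: leqP => _; apply/orP; [left|right].
    have -> : mu / l = 4 * y by rewrite /y; field; lra.
    by move: ty2; rewrite -natr1; lra.
  have := leq_half_mul4 n n2.
  by rewrite -(ler_nat R) natrM; lra.
have c0 : 0 <= kappa R ^+ 2 / 96 by rewrite divr_ge0// exprn_ge0// ltW.
by have := ler_wpM2l c0 KM; lra.
Qed.
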